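(* The word problem for an amalgam $[S_1,S_2;U,\omega_1,\omega_2]$ of inverse semigroups may be undecidable even if we assume $S_1$ and $S_2$ (and therefore $U$) to have finite Green $\mathcal{R}$-classes and $\omega_1,\omega_2$ to be computable functions. That is, there exists an amalgam $[S_1,S_2;U,\omega_1,\omega_2]$ of inverse semigroups such that $S_1$ and $S_2$ (and therefore $U$) have finite $\mathcal{R}$-classes, $\omega_1$ and $\omega_2$ are computable functions, and the word problem for the amalgamated free product $S_1*_US_2$ (in the category of inverse semigroups) is undecidable.
   Context: For a set $X$ write $\widetilde{X}=X\cup X^{-1}$, where $X^{-1}$ is a disjoint set of formal inverses. For $R\subseteq \widetilde{X}^+\times\widetilde{X}^+$, $\mathrm{Inv}\langle X\mid R\rangle$ denotes the inverse semigroup $\widetilde{X}^+/\tau$, where $\tau$ is the congruence generated by $R$ together with the Vagner congruence (the least congruence on $\widetilde X^+$ whose quotient is inverse, with the class of $x^{-1}$ being the inverse of the class of $x$). An amalgam $[S_1,S_2;U,\omega_1,\omega_2]$ of inverse semigroups consists of inverse semigroups $S_1,S_2,U$ and monomorphisms $\omega_i:U\to S_i$ ($i=1,2$). Here $S_i$ is given by a presentation $\mathrm{Inv}\langle X_i\mid R_i\rangle$ ($i=1,2$) with $X_1\cap X_2=\emptyset$. If $\lambda_i:S_i\to\widetilde{X_i}^+$ is a map picking for each element a word representing it, the free product with amalgamation $S_1*_US_2$ is the inverse semigroup $\mathrm{Inv}\langle X_1\cup X_2\mid R_1\cup R_2\cup R_3\rangle$ with $R_3=\{(\lambda_1(\omega_1(u)),\lambda_2(\omega_2(u)))\mid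 u\in U\}$. The word problem for the amalgam is the word problem for $S_1*_US_2$: given two words in $(\widetilde{X_1\cup X_2})^+$, decide whether they represent the same element of $S_1*_US_2$. That $\omega_i$ is computable means that there is an algorithm which, given a word over the generators of $U$ and their inverses representing $u\in U$, outputs a word in $\widetilde{X_i}^+$ representing $\omega_i(u)$. *)

(* Defs.v *)
From HB Require Import structures.
From mathcomp Require Import all_boot.
From mathcomp Require Import boolp classical_sets functions cardinality.

Set Implicit Arguments.
Unset Strict Implicit.
Unset Printing Implicit Defensive.

Import Algebra.

Local Open Scope classical_set_scope.
Local Open Scope quotient_scope.
Local Open Scope group_scope.

Definition inverse_of (S : semigroupType) (x y : S) : Prop :=
  x * y * x = x /\ y * x * y = y.

Definition inverse_semigroup (S : semigroupType) : Prop :=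
  forall x : S, exists! y : S, inverse_of x y.

(* The disjunct [x = y] is the adjoined identity of [y S^1]. *)
Definition in_right_ideal (S : semigroupType) (x y : S) : Prop :=
  x = y \/ exists a : S, x = y * a.

Definition green_R (S : semigroupType) (x y : S) : Prop :=
  in_right_ideal x y /\ in_right_ideal y x.

Definition finite_R_classes (S : semigroupType) : Prop :=
  forall x : S, finite_set [set y | green_R y x].

Record congruence (S : semigroupType) := Congruence {
  cong :> S -> S -> Prop;
  cong_refl : forall x, cong x x;
  cong_sym : forall x y, cong x y -> cong y x;
  cong_trans : forall y x z, cong x y -> cong y z -> cong x z;
  cong_mul : forall x y z t, cong x y -> cong z t -> cong (x * z) (y * t) }.

Section Quotient.
Variables (S : semigroupType) (rho : congruence S).

Definition congb : rel S := fun x y => `[< rho x y >].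

Fact congb_refl : reflexive congb.
Proof. by move=> x; apply/asboolP/cong_refl. Qed.

Fact congb_sym : symmetric congb.
Proof. by move=> x y; apply/asboolP/asboolP; apply: cong_sym. Qed.

Fact congb_trans : transitive congb.
Proof.
by move=> y x z /asboolP xy /asboolP yz; apply/asboolP/(cong_trans xy yz).
Qed.

Definition cong_equiv : equiv_rel S :=
  EquivRel congb congb_refl congb_sym congb_trans.

Definition Quot : Type := {eq_quot cong_equiv}.

HB.instance Definition _ := Quotient.on Quot.
HB.instance Definition _ := Choice.on Quot.

Lemma Quot_eqP (x y : S) : \pi_Quot x = \pi_Quot y <-> rho x y.
Proof.
split=> [/eqmodP /asboolP h|xy]; first exact: h.
by apply/eqmodP/asboolP.
Qed.

Definition Quot_mul (a b : Quot) : Quot :=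
  locked (\pi_Quot (repr a * repr b)).

Lemma Quot_piM (x y : S) : Quot_mul (\pi_Quot x) (\pi_Quot y) = \pi_Quot (x * y).
Proof.
rewrite /Quot_mul -lock.
by apply/Quot_eqP/cong_mul; apply/Quot_eqP; rewrite reprK.
Qed.

Fact Quot_mulA : associative Quot_mul.
Proof.
move=> a b c; rewrite -(reprK a) -(reprK b) -(reprK c).
by rewrite !Quot_piM mulgA.
Qed.

HB.instance Definition _ := isSemigroup.Build Quot Quot_mulA.

Lemma QuotM (x y : S) : \pi_Quot (x * y) = \pi_Quot x * \pi_Quot y.
Proof. by rewrite -Quot_piM. Qed.

End Quotient.

Section GeneratedCongruence.
Variables (S : semigroupType) (r : S -> S -> Prop).

Definition gen_rel (x y : S) : Prop :=
  forall rho : congruence S, (forall u v, r u v -> rho u v) -> rho x y.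

Definition gen_cong : congruence S.
Proof.
exists gen_rel.
- by move=> x rho _; apply: cong_refl.
- by move=> x y h rho rP; apply/cong_sym/h.
- by move=> y x z xy yz rho rP; apply: cong_trans (xy rho rP) (yz rho rP).
- by move=> x y z t xy zt rho rP; apply: cong_mul (xy rho rP) (zt rho rP).
Defined.

End GeneratedCongruence.

(* [inl x] is the generator [x], [inr x] its formal inverse. *)
Definition letter (X : Type) : Type := (X + X)%type.

Section Words.
Variable X : countType.

Definition word : Type := {w : seq (X + X)%type | w != [::]}.

HB.instance Definition _ := SubCountable.on word.

Fact word_cat_subproof (u v : word) : val u ++ val v != [::].
Proof. by case: u => [[|a u] //]. Qed.

Definition word_cat (u v : word) : word := Sub (val u ++ val v) (word_cat_subproof u v).

Fact word_catA : associative word_cat.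
Proof. by move=> u v w; apply: val_inj; rewrite /= catA. Qed.

HB.instance Definition _ := isSemigroup.Build word word_catA.

Definition letter_word (a : letter X) : word := Sub [:: a] isT.

Definition inverse_congruence (rho : congruence word) : Prop :=
  inverse_semigroup (Quot rho) /\
  forall x : X, inverse_of (\pi_(Quot rho) (letter_word (inl x)))
                           (\pi_(Quot rho) (letter_word (inr x))).

Definition vagner (u v : word) : Prop :=
  forall rho : congruence word, inverse_congruence rho -> rho u v.

Definition tau (R : set (word * word)) : congruence word :=
  gen_cong (fun u v => R (u, v) \/ vagner u v).

Definition InvSg (R : set (word * word)) : semigroupType := Quot (tau R).

End Words.

Section InverseTheory.
Variable S : semigroupType.
Implicit Types x y e f : S.

Lemma inverse_of_sym x y : inverse_of x y -> inverse_of y x.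
Proof. by case. Qed.

Lemma inverse_idem_comm : inverse_semigroup S ->
  forall e f, e * e = e -> f * f = f -> e * f = f * e.
Proof.
move=> invS.
have uniq x y z : inverse_of x y -> inverse_of x z -> y = z.
  by case: (invS x) => t [_ tP] /tP <- /tP.
have idemM e f : e * e = e -> f * f = f -> (e * f) * (e * f) = e * f.
  move=> ee ff; have [x [[efx xef] _]] := invS (e * f).
  have xE : f * x * e = x.
    apply: (uniq (e * f)) => //; split.
    - rewrite -[RHS]efx !mulgA -(mulgA e f f) ff.
      by rewrite -(mulgA _ e e) ee.
    - rewrite -[in RHS]xef !mulgA -(mulgA _ e e) ee.
      by rewrite -(mulgA _ f f) ff.
  have xx : x * x = x.
    rewrite -[in LHS]xE -[RHS]xE -[in RHS]xef !mulgA.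
    by [].
  have -> : e * f = x.
    by apply: (uniq x); split=> //; rewrite ?xx ?xx.
  exact: xx.
move=> e f ee ff; apply: (uniq (e * f)); first by split; rewrite idemM ?idemM.
have ef := idemM e f ee ff; have fe := idemM f e ff ee.
split.
- rewrite !mulgA -(mulgA e f f) ff -(mulgA _ e e) ee.
  by rewrite -mulgA ef.
- rewrite !mulgA -(mulgA f e e) ee -(mulgA _ f f) ff.
  by rewrite -mulgA fe.
Qed.

Lemma inverse_ofM x x' y y' : inverse_semigroup S ->
  inverse_of x x' -> inverse_of y y' -> inverse_of (x * y) (y' * x').
Proof.
move=> /inverse_idem_comm comm [xx' x'x] [yy' y'y].
have c : (x' * x) * (y * y') = (y * y') * (x' * x).
  by apply: comm; rewrite mulgA ?x'x ?yy'.
split.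
- have -> : x * y * (y' * x') * (x * y) = x * ((y * y') * (x' * x)) * y.
    by rewrite !mulgA.
  by rewrite -c !mulgA xx' -!mulgA (mulgA y) yy'.
- have -> : y' * x' * (x * y) * (y' * x') = y' * ((x' * x) * (y * y')) * x'.
    by rewrite !mulgA.
  by rewrite c !mulgA y'y -!mulgA (mulgA x') x'x.
Qed.

Lemma inverse_semigroup_equational (J : S -> S -> Prop) :
    (forall x, exists y, J x y) -> (forall x y, J x y -> J y x) ->
    (forall x y, J x y -> inverse_of x y) ->
    (forall x x' y y', J x x' -> J y y' ->
       (x * x') * (y * y') = (y * y') * (x * x')) ->
  inverse_semigroup S.
Proof.
move=> Jex Jsym Jinv Jcomm.
have idemJ e : e * e = e -> exists x x', J x x' /\ e = x * x'.
  move=> ee; have [e' ee'] := Jex e; exists e, e'; split=> //.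
  have [h h'] := Jinv _ _ ee'.
  have c := Jcomm _ _ _ _ ee' (Jsym _ _ ee').
  have e'E : (e' * e) * (e * e') = e' by rewrite !mulgA -(mulgA _ e e) ee.
  have e1 : e' * e = e'.
    by rewrite -[in LHS]e'E -c !mulgA -(mulgA _ e e) ee -[RHS]e'E -c !mulgA.
  have e2 : e * e' = e'.
    by rewrite -[in LHS]e'E -c !mulgA ee -[RHS]e'E -c !mulgA.
  by rewrite -[LHS]h e2 e1.
have comm e f : e * e = e -> f * f = f -> e * f = f * e.
  move=> /idemJ [x [x' [xx' ->]]] /idemJ [y [y' [yy' ->]]]; exact: Jcomm.
move=> x; have [y /Jinv xy] := Jex x; exists y; split=> // z xz.
case: xy xz => [xyx yxy] [xzx zxz].
have -> : y = y * x * z.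
  rewrite -[LHS]yxy -{1}xzx.
  have -> : y * (x * z * x) * y = y * ((x * z) * (x * y)) by rewrite !mulgA.
  rewrite (comm (x * z)); first by rewrite !mulgA yxy.
    by rewrite mulgA xzx.
  by rewrite mulgA xyx.
rewrite -[RHS]zxz -{2}xyx.
have -> : z * (x * y * x) * z = ((z * x) * (y * x)) * z by rewrite !mulgA.
rewrite (comm (z * x)).
- by rewrite -!mulgA [z * (x * z)]mulgA zxz.
- by rewrite mulgA zxz.
- by rewrite mulgA yxy.
Qed.

End InverseTheory.

Section InvInverse.
Variable X : countType.

Definition letter_inv (a : letter X) : letter X :=
  match a with inl x => inr x | inr x => inl x end.

Fact word_inv_subproof (w : word X) : rev (map letter_inv (val w)) != [::].
Proof. by rewrite -size_eq0 size_rev size_map size_eq0 (valP w). Qed.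

Definition word_inv (w : word X) : word X := 
  Sub (rev (map letter_inv (val w))) (word_inv_subproof w).

Lemma word_invK : involutive word_inv.
Proof.
move=> w; apply: val_inj; rewrite /= -map_rev revK -map_comp map_id_in //.
by case.
Qed.

Lemma word_ind (P : word X -> Prop) :
    (forall a, P (letter_word a)) ->
    (forall a w, P w -> P (letter_word a * w)) ->
  forall w, P w.
Proof.
move=> P1 PM [s]; elim: s => [|a [|b s] IHs] // ns.
  suff -> : exist _ [:: a] ns = letter_word a by [].
  exact: val_inj.
suff -> : exist _ [:: a, b & s] ns = letter_word a * exist _ (b :: s) isT.
  exact/PM/IHs.
exact: val_inj.
Qed.

Lemma inverse_congruence_word (rho : congruence (word X)) (w : word X) :
  inverse_congruence rho ->
  inverse_of (\pi_(Quot rho) w) (\pi_(Quot rho) (word_inv w)).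
Proof.
case=> invQ letQ; elim/word_ind: w => [a|a w IHw].
  have -> : word_inv (letter_word a) = letter_word (letter_inv a).
    exact: val_inj.
  by case: a => x; [|apply: inverse_of_sym]; apply: letQ.
have -> : word_inv (letter_word a * w) =
          word_inv w * letter_word (letter_inv a).
  by apply: val_inj; rewrite /= rev_cons -cats1.
rewrite !QuotM; apply: inverse_ofM => //.
by case: a => x; [|apply: inverse_of_sym]; apply: letQ.
Qed.

Lemma vagner_inv (w : word X) : vagner (w * word_inv w * w) w.
Proof.
move=> rho rhoP; have [h _] := inverse_congruence_word w rhoP.
by apply/Quot_eqP; rewrite !QuotM.
Qed.

Lemma vagner_comm (u v : word X) :
  vagner ((u * word_inv u) * (v * word_inv v))
         ((v * word_inv v) * (u * word_inv u)).
Proof.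
move=> rho rhoP; apply/Quot_eqP; rewrite !QuotM.
have [hu _] := inverse_congruence_word u rhoP.
have [hv _] := inverse_congruence_word v rhoP.
by apply: (inverse_idem_comm rhoP.1); rewrite mulgA ?hu ?hv.
Qed.

Variable R : set (word X * word X).

Lemma InvSg_word (w : word X) :
  inverse_of (\pi_(InvSg R) w) (\pi_(InvSg R) (word_inv w)).
Proof.
have h u : \pi_(InvSg R) u * \pi_(InvSg R) (word_inv u) * \pi_(InvSg R) u =
           \pi_(InvSg R) u.
  rewrite -!QuotM; apply/Quot_eqP => rho; apply.
  by right; apply: vagner_inv.
split; first exact: h.
by have := h (word_inv w); rewrite word_invK.
Qed.

Lemma InvSg_inverse : inverse_semigroup (InvSg R).
Proof.
pose J (x y : InvSg R) := exists w,
  x = \pi_(InvSg R) w /\ y = \pi_(InvSg R) (word_inv w).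
apply: (@inverse_semigroup_equational _ J).
- by move=> x; exists (\pi_(InvSg R) (word_inv (repr x))), (repr x); rewrite reprK.
- by move=> x y [w [-> ->]]; exists (word_inv w); rewrite word_invK.
- by move=> x y [w [-> ->]]; apply: InvSg_word.
move=> x x' y y' [u [-> ->]] [v [-> ->]].
rewrite -!QuotM; apply/Quot_eqP => rho; apply.
by right; apply: vagner_comm.
Qed.

End InvInverse.

Record amalgam (S1 S2 U : semigroupType) := Amalgam {
  amalgam_inverse1 : inverse_semigroup S1;
  amalgam_inverse2 : inverse_semigroup S2;
  amalgam_inverse : inverse_semigroup U;
  omega1 : Multiplicative.type U S1;
  omega2 : Multiplicative.type U S2;
  omega1_inj : injective omega1;
  omega2_inj : injective omega2 }.

Section WordMap.
Variables (X Y : countType) (f : X -> Y).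

Definition letter_map (a : letter X) : letter Y :=
  match a with inl x => inl (f x) | inr x => inr (f x) end.

Fact word_map_subproof (w : word X) : map letter_map (val w) != [::].
Proof. by rewrite -size_eq0 size_map size_eq0 (valP w). Qed.

Definition word_map (w : word X) : word Y :=
  Sub (map letter_map (val w)) (word_map_subproof w).

End WordMap.

Section AmalgamatedFreeProduct.
Variables (X1 X2 : countType).
Variables (R1 : set (word X1 * word X1)) (R2 : set (word X2 * word X2)).
Variables (U : semigroupType) (A : amalgam (InvSg R1) (InvSg R2) U).
Variables (lambda1 : InvSg R1 -> word X1) (lambda2 : InvSg R2 -> word X2).

(* The disjoint union of the generating sets is the sum type [X1 + X2]. *)
Let X12 : countType := (X1 + X2)%type.
Let i1 : word X1 -> word X12 := word_map inl.
Let i2 : word X2 -> word X12 := word_map inr.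

Definition amalgam_rel : set (word X12 * word X12) :=
  [set (i1 r.1, i1 r.2) | r in R1] `|` [set (i2 r.1, i2 r.2) | r in R2] `|`
  [set (i1 (lambda1 (omega1 A u)), i2 (lambda2 (omega2 A u))) | u in [set: U]].

Definition amalgamated_free_product : semigroupType := InvSg amalgam_rel.

End AmalgamatedFreeProduct.

Inductive recfun : nat -> Type :=
| Zero k : recfun k
| Succ : recfun 1
| Proj k (i : 'I_k) : recfun k
| Comp k m (f : recfun m) (g : 'I_m -> recfun k) : recfun k
| PrimRec k (f : recfun k) (g : recfun k.+2) : recfun k.+1
| Mu k (f : recfun k.+1) : recfun k.

(* [evalrec f v y]: the partial recursive function [f] is defined at [v], with
   value [y].
   The recursion (resp. search) variable is the first argument; the step
   function of [PrimRec] takes the index, the previous value and the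
   parameters, in this order. *)
Fixpoint evalrec k (f : recfun k) : k.-tuple nat -> nat -> Prop :=
  match f in recfun k return k.-tuple nat -> nat -> Prop with
  | Zero _ => fun _ y => y = 0
  | Succ => fun v y => y = (thead v).+1
  | Proj _ i => fun v y => y = tnth v i
  | Comp _ m f g => fun v y => exists w : m.-tuple nat,
      (forall i, evalrec (g i) v (tnth w i)) /\ evalrec f w y
  | PrimRec _ f g => fun v y => exists s : nat -> nat,
      [/\ evalrec f [tuple of behead v] (s 0),
          forall i, i < thead v ->
            evalrec g [tuple of i :: s i :: behead v] (s i.+1)
        & y = s (thead v)]
  | Mu _ f => fun v y =>
      evalrec f [tuple of y :: v] 0 /\
      forall i, i < y -> exists z, evalrec f [tuple of i :: v] z.+1
  end.

(* Generators are numbered by [pickle], which is the identity on [nat]; on a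
   finite generating set the choice of the numbering is immaterial.  The map
   [CodeSeq.code] is an effective bijection between [seq nat] and [nat]. *)
Definition letter_code (X : countType) (a : letter X) : nat :=
  match a with inl x => (pickle x).*2 | inr x => (pickle x).*2.+1 end.

Definition word_code (X : countType) (w : word X) : nat :=
  CodeSeq.code (map (@letter_code X) (val w)).

(* With [Y = nat] the generators form a sequence y_0, y_1, ..., possibly with
   repetitions, so that finite generating sets are covered as well. *)
Definition computable_map (Y X : countType) (P : set (word Y * word Y))
    (R : set (word X * word X)) (omega : InvSg P -> InvSg R) : Prop :=
  exists f : recfun 1, forall w : word Y, exists v : word X,
    evalrec f [tuple word_code w] (word_code v) /\
    omega (\pi_(InvSg P) w) = \pi_(InvSg R) v.

Definition decidable_word_problem (X : countType)
    (R : set (word X * word X)) : Prop :=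
  exists f : recfun 2, forall u v : word X,
    (\pi_(InvSg R) u = \pi_(InvSg R) v ->
       evalrec f [tuple word_code u; word_code v] 1) /\
    (\pi_(InvSg R) u <> \pi_(InvSg R) v ->
       evalrec f [tuple word_code u; word_code v] 0).

(* Main.v *)
Require Import Defs.
From HB Require Import structures.
From mathcomp Require Import all_boot.
From mathcomp Require Import boolp classical_sets functions cardinality.
From mathcomp Require Import zify.

Set Implicit Arguments.
Unset Strict Implicit.
Unset Printing Implicit Defensive.

Local Open Scope quotient_scope.

(** The theorem holds because gluing two semigroups along a subsemigroup can
hide an enumeration: it is computable which elements the [n]-th generator of
[U] glues together, but not whether a given pair of elements is ever glued.

Let [S_1] and [S_2] be free inverse semigroups on one generator, [a] and [b].
The idempotents [e_k = a^(k+1) a^-(k+1)] of [S_1] (the spikes below) form a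
strictly descending chain, [e_m e_n = e_max(m,n)] ([spike_mul], [spike_inj]),
and so do the corresponding [e'_k] in [S_2].  Hence for any [f : nat -> nat]
the [e_(f n)] form a subsemigroup of [S_1], and the [e'_(f n)] an isomorphic
one of [S_2].  Let [U] be this semilattice, generated by [y_0, y_1, ...], with
[y_n] sent to [e_(f n)] and to [e'_(f n)]; two words in the [y_n] are equal in
[U] when the maximum of [f] over their indices is the same ([weight]).  Both
embeddings are computable as soon as [f] is.  The [R]-class of an element
[x = w] of [S_i] is finite because every element is an idempotent times a
power of a letter ([mul_letters_factor]), the idempotent can be taken to be
[x x^-1] on the whole class, and the exponent is at most the length of [w].

In the amalgamated product [e_k = e'_k] if and only if [k] is a value of [f]
([spike_amalgam_eq]).  If [k = f n] the equality is one of the defining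
relations.  Otherwise, let [a] and [b] act as the two child maps of a binary
tree, cut off at depth [k] in the branches that leave the root along [a] and
at depth [k+1] in those that leave it along [b] ([branch]).  For [n <> k] the
idempotents [e_n] and [e'_n] have the same domain, so this is an action of the
amalgamated product; but [e_k] is undefined at the root while [e'_k] is not.

A decision procedure for the word problem would therefore decide the range of
[f], and it remains to find a computable [f] with undecidable range.  All
recursive functions are compiled ([compile]) into programs for a stack machine
whose states are single numbers and whose step function is computable.  The
set of programs that output 0 when run on their own number is undecidable by
diagonalization ([rejects_itself_undecidable]), and running every program for
every number of steps enumerates it ([enum_rejects]). *)

(** * Total recursive functions *)

(** The argument tuple is read as a sequence, so that composition needs no
dependent types; only the values of [F] on sequences of length [k] matter. *)
Definition computable (k : nat) (F : seq nat -> nat) : Prop :=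
  exists f : recfun k, forall v : k.-tuple nat, evalrec f v (F v).

Lemma computable_ext k F G :
  (forall v, size v = k -> F v = G v) -> computable k F -> computable k G.
Proof. by move=> FG [f fP]; exists f => v; rewrite -FG ?size_tuple. Qed.

Lemma computable_comp k m F (G : 'I_m -> seq nat -> nat) :
  computable m F -> (forall i, computable k (G i)) ->
  computable k (fun v => F [seq G i v | i <- enum 'I_m]).
Proof.
move=> [f fP] /choice [g gP]; exists (Comp f g) => v /=.
exists [tuple G i v | i < m]; split=> [i|]; first by rewrite tnth_mktuple.
exact: fP.
Qed.

Lemma computable_var k i : i < k -> computable k (fun v => nth 0 v i).
Proof. by move=> ik; exists (Proj (Ordinal ik)) => v /=;
  rewrite (tnth_nth 0). Qed.

Lemma computable_drop k m F : computable k F ->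
  computable (m + k) (fun v => F (drop m v)).
Proof.
move=> FP.
apply: computable_ext (computable_comp (G :=
  fun i v => nth 0 v (m + i)) FP _); last first.
  by move=> i; apply: computable_var; rewrite ltn_add2l.
move=> v sv; congr F; apply: (@eq_from_nth _ 0).
  by rewrite size_map size_enum_ord size_drop sv addKn.
rewrite size_map size_enum_ord => i ik.
by rewrite nth_drop (nth_map (Ordinal ik)) ?size_enum_ord ?nth_enum_ord.
Qed.

Lemma computable_drop2 k F : computable k F ->
  computable k.+2 (fun v => F (drop 2 v)).
Proof. exact: (@computable_drop k 2). Qed.

Lemma computable_succ k F : computable k F -> computable k (fun v => (F v).+1).
Proof.
move=> FP; have SP : computable 1 (fun v => (head 0 v).+1).
  by exists Succ => v /=; case/tupleP: v => x v; rewrite theadE.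
apply: computable_ext (computable_comp (G := fun=> F) SP (fun=> FP)) => v _.
by rewrite enum_ordSl.
Qed.

Lemma computable_zero k : computable k (fun=> 0).
Proof. by exists (Zero k). Qed.

Lemma computable_const k c : computable k (fun=> c).
Proof. by elim: c => [|c IHc];
  [apply: computable_zero|apply: computable_succ]. Qed.

(** The step [H] sees the variables of the enclosing context beyond the index
and the accumulator, as [drop 2 u]; this lets all later closure properties be
stated for functions in an arbitrary context. *)
Lemma computable_primrec k N F H :
  computable k N -> computable k F ->
  computable k.+2 (fun u => H (nth 0 u 0) (nth 0 u 1) (drop 2 u)) ->
  computable k (fun v => nat_rect (fun=> nat) (F v) (fun i s => H i s v) (N v)).
Proof.
move=> NP [f fP] [h hP].
have RP : computable k.+1 (fun u => nat_rect (fun=> nat) (F (behead u))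
    (fun i s => H i s (behead u)) (head 0 u)).
  exists (PrimRec f h) => u; case/tupleP: u => n v /=.
  exists (nat_rect (fun=> nat) (F v) (fun i s => H i s v)); split=> //.
  move=> i _; set s := nat_rect _ _ _ _.
  have := hP [tuple of i :: s :: v]; rewrite /= drop0.
  by congr (evalrec h _); apply: val_inj.
apply: computable_ext (computable_comp RP
  (G := fun i v => if i == 0 :> nat then N v else nth 0 v i.-1) _).
  move=> v sv; rewrite enum_ordSl /= -map_comp.
  set G := fun i : 'I_k.+1 => _.
  have -> : [seq (G \o lift ord0) i | i <- enum 'I_k] = v; last by [].
  apply: (@eq_from_nth _ 0); first by rewrite size_map size_enum_ord.
  rewrite size_map size_enum_ord => i ik.
  by rewrite (nth_map (Ordinal ik)) ?size_enum_ord // /G /= nth_enum_ord.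
case=> [[|i] ik] //=.
exact: computable_var.
Qed.

Lemma computable_add k F G : computable k F -> computable k G ->
  computable k (fun v => F v + G v).
Proof.
move=> FP GP; apply: computable_ext
  (computable_primrec (N := G) (F := F) (H := fun _ s _ => s.+1) GP FP _).
  by move=> v _; elim: (G v) => [|n /= ->]; rewrite ?addn0 ?addnS.
by apply: computable_succ; apply: computable_var.
Qed.

Lemma computable_mul k F G : computable k F -> computable k G ->
  computable k (fun v => F v * G v).
Proof.
move=> FP GP; apply: computable_ext (computable_primrec (N := G) (F := fun=> 0)
  (H := fun _ s v => F v + s) GP (computable_const k 0) _).
  by move=> v _; elim: (G v) => [|n /= ->]; rewrite ?muln0 ?mulnS.
by apply: computable_add; [apply: computable_drop2|apply: computable_var].
Qed.

Lemma computable_pred k F : computable k F -> computable k (fun v => (F v).-1).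
Proof.
move=> FP; apply: computable_ext (computable_primrec (N := F) (F := fun=> 0)
  (H := fun i _ _ => i) FP (computable_const k 0) _).
  by move=> v _; case: (F v).
exact: computable_var.
Qed.

Lemma computable_sub k F G : computable k F -> computable k G ->
  computable k (fun v => F v - G v).
Proof.
move=> FP GP; apply: computable_ext
  (computable_primrec (N := G) (F := F) (H := fun _ s _ => s.-1) GP FP _).
  by move=> v _; elim: (G v) => [|n /= ->]; rewrite ?subn0 ?subnS.
by apply: computable_pred; apply: computable_var.
Qed.

(** The characteristic function of [A v <= B v] is [1 - (A v - B v)], with
truncated subtractions. *)
Lemma computable_leq k A B F G : computable k A -> computable k B ->
  computable k F -> computable k G ->
  computable k (fun v => if A v <= B v then F v else G v).
Proof.
move=> AP BP FP GP; apply: computable_ext (_ : computable k (fun v =>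
  (1 - (A v - B v)) * F v + (1 - (1 - (A v - B v))) * G v)).
  by move=> v _; rewrite -subn_eq0; case: (A v - B v) => [|n] /=; lia.
by do ?[apply: computable_add|apply: computable_mul|apply: computable_sub];
  auto; apply: computable_const.
Qed.

Lemma computable_eq k A B F G : computable k A -> computable k B ->
  computable k F -> computable k G ->
  computable k (fun v => if A v == B v then F v else G v).
Proof.
move=> AP BP FP GP; apply: computable_ext (_ : computable k (fun v =>
  if A v <= B v then if B v <= A v then F v else G v else G v)).
  by move=> v _; rewrite eqn_leq; case: (A v <= B v).
by do !apply: computable_leq.
Qed.

Lemma computable_max k F G : computable k F -> computable k G ->
  computable k (fun v => maxn (F v) (G v)).
Proof.
move=> FP GP; apply: computable_ext (computable_add FP (computable_sub GP FP))
  => v _.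
by rewrite maxnE.
Qed.

Lemma computable_iter k N F H : computable k N -> computable k F ->
  computable k.+2 (fun u => H (nth 0 u 1) (drop 2 u)) ->
  computable k (fun v => iter (N v) (fun s => H s v) (F v)).
Proof.
move=> NP FP HP; apply: computable_ext (computable_primrec
  (H := fun _ s v => H s v) NP FP HP) => v _.
by elim: (N v) => //= n ->.
Qed.

Lemma computable_pow2 k F : computable k F -> computable k (fun v => 2 ^ F v).
Proof.
move=> FP; apply: computable_ext (computable_iter (F := fun=> 1) (H :=
  fun s _ => 2 * s)
  FP (computable_const _ _) _).
  by move=> v _; elim: (F v) => //= n ->; rewrite expnS.
by apply: computable_mul; [apply: computable_const|apply: computable_var].
Qed.

Lemma computable_sum k N H : computable k N ->
  computable k.+2 (fun u => H (nth 0 u 0) (drop 2 u)) ->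
  computable k (fun v => \sum_(i < N v) H i v).
Proof.
move=> NP HP; apply: computable_ext (computable_primrec (F := fun=> 0)
  (H := fun i s v => s + H i v) NP (computable_const k 0) _).
  by move=> v _; elim: (N v) => [|n /= ->]; rewrite ?big_ord0 ?big_ord_recr.
by apply: computable_add => //; apply: computable_var.
Qed.

(** Bounded searches are computed as bounded sums of characteristic functions,
which this identity evaluates when the predicate is an initial segment. *)
Lemma sum_ltn n q : \sum_(i < n) (if i < q then 1 else 0) = minn n q.
Proof.
elim: n => [|n IHn]; first by rewrite big_ord0 min0n.
by rewrite big_ord_recr /= IHn; case: ltnP => h; lia.
Qed.

Lemma computable_div k F G : (forall v, 0 < G v) -> computable k F ->
  computable k G ->
  computable k (fun v => F v %/ G v).
Proof.
move=> G0 FP GP; apply: computable_ext (computable_sum (N := F)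
  (H := fun i v => if i.+1 * G v <= F v then 1 else 0) FP _).
  move=> v _; have -> : F v %/ G v = minn (F v) (F v %/ G v).
    by apply/esym/minn_idPr/leq_div.
  rewrite -sum_ltn; apply: eq_bigr => i _.
  by rewrite -leq_divRL.
apply: computable_leq; [apply: computable_mul| | |].
- by apply: computable_succ; apply: computable_var.
- exact: computable_drop2.
- exact: computable_drop2.
- exact: computable_const.
- exact: computable_const.
Qed.

(** * Sequences coded by numbers *)

(** The list operations transported along [CodeSeq.code]: a number is the code
of a sequence, with 0 for the empty one. *)
Definition chead (n : nat) : nat := head 0 (CodeSeq.decode n).
Definition ctail (n : nat) : nat := CodeSeq.code (behead (CodeSeq.decode n)).
Definition ccons (a s : nat) : nat := 2 ^ a * s.*2.+1.

Lemma code_cons a s : CodeSeq.code (a :: s) = ccons a (CodeSeq.code s).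
Proof. by []. Qed.

Lemma chead_ccons a s : chead (ccons a s) = a.
Proof. by rewrite /chead -[s]CodeSeq.decodeK -code_cons CodeSeq.codeK. Qed.

Lemma ctail_ccons a s : ctail (ccons a s) = s.
Proof. by rewrite /ctail -[s]CodeSeq.decodeK -code_cons CodeSeq.codeK. Qed.

Lemma chead0 : chead 0 = 0. Proof. by []. Qed.
Lemma ctail0 : ctail 0 = 0. Proof. by []. Qed.

Lemma ccons_gt0 a s : 0 < ccons a s.
Proof. by rewrite muln_gt0 expn_gt0. Qed.

Lemma ccons_chead_ctail n : 0 < n -> ccons (chead n) (ctail n) = n.
Proof.
move=> n0; rewrite -[in RHS](CodeSeq.decodeK n) /chead /ctail.
case E: (CodeSeq.decode n) => [|a s] //.
by move: n0; rewrite -(CodeSeq.decodeK n) E.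
Qed.

(** The head is the 2-adic valuation of the code: the number of positive
[j <= n] such that [2 ^ j] divides [n]. *)
Lemma chead_sum n : chead n =
  \sum_(i < n) (if 2 ^ i.+1 * (n %/ 2 ^ i.+1) == n then 1 else 0).
Proof.
case: (posnP n) => [->|/ccons_chead_ctail nE]; first by rewrite big_ord0 chead0.
have hn : chead n <= n.
  rewrite -[leqRHS]nE; apply: leq_trans (ltnW (ltn_expl _ (isT : 1 < 2))) _.
  exact: leq_pmulr.
rewrite -[LHS](minn_idPr hn).
have dvdE i : (2 ^ i.+1 * (n %/ 2 ^ i.+1) == n) = (i < chead n).
  rewrite mulnC -dvdn_eq -nE Gauss_dvdl ?dvdn_Pexp2l ?nE //.
  by rewrite coprimeXl // coprime2n /= odd_double.
by rewrite -sum_ltn; apply: eq_bigr => i _; rewrite dvdE.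
Qed.

Lemma ctail_div n : ctail n = n %/ 2 ^ chead n %/ 2.
Proof.
case: (posnP n) => [->|/ccons_chead_ctail nE]; first by rewrite ctail0 !div0n.
by rewrite -[in RHS]nE chead_ccons mulKn ?expn_gt0 // divn2 /= uphalf_double.
Qed.

Lemma computable_chead k F : computable k F ->
  computable k (fun v => chead (F v)).
Proof.
move=> FP; apply: computable_ext (computable_sum (N := F) (H := fun i v =>
  if 2 ^ i.+1 * (F v %/ 2 ^ i.+1) == F v then 1 else 0) FP _).
  by move=> v _; rewrite chead_sum.
have EP : computable k.+2 (fun u => 2 ^ (nth 0 u 0).+1).
  by apply: computable_pow2; apply: computable_succ; apply: computable_var.
have FP' := computable_drop2 FP.
apply: computable_eq; rewrite //; try exact: computable_const.
by apply: computable_mul => //; apply: computable_div => // v; rewrite expn_gt0.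
Qed.

Lemma computable_ctail k F : computable k F ->
  computable k (fun v => ctail (F v)).
Proof.
move=> FP; apply: computable_ext (_ :
  computable k (fun v => F v %/ 2 ^ chead (F v) %/ 2)).
  by move=> v _; rewrite ctail_div.
apply: computable_div => //; last exact: computable_const.
apply: computable_div => // [v|]; first by rewrite expn_gt0.
by apply: computable_pow2; apply: computable_chead.
Qed.

Lemma computable_ccons k F G : computable k F -> computable k G ->
  computable k (fun v => ccons (F v) (G v)).
Proof.
move=> FP GP; apply: computable_ext (_ :
  computable k (fun v => 2 ^ F v * (2 * G v).+1)).
  by move=> v _; rewrite mul2n.
by do ?[apply: computable_mul|apply: computable_pow2|apply: computable_succ]=>
  //; apply: computable_const.
Qed.

(* Computing with these operations would expand unary powers of 2. *)
Opaque chead ctail ccons.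

Arguments CodeSeq.code : simpl never.

(** * A universal stack machine *)

(** A program is a coded pair of an opcode and an argument, which is 0 for the
operations on data. *)
Definition seq_op (p q : nat) : nat := ccons 0 (ccons p q).
Definition while_op (b : nat) : nat := ccons 1 b.
Definition dup_op : nat := ccons 2 0.
Definition swap_op : nat := ccons 3 0.
Definition cons_op : nat := ccons 4 0.
Definition zero_op : nat := ccons 5 0.
Definition succ_op : nat := ccons 6 0.
Definition pred_op : nat := ccons 7 0.
Definition head_op : nat := ccons 8 0.
Definition tail_op : nat := ccons 9 0.

(** [x] is the top of the data stack and [D] the rest. *)
Definition data_step (op x D : nat) : nat :=
  if op == 2 then ccons x (ccons x D) else
  if op == 3 then ccons (chead D) (ccons x (ctail D)) else
  if op == 4 then ccons (ccons (chead D) x) (ctail D) else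
  if op == 5 then ccons 0 D else
  if op == 6 then ccons x.+1 D else
  if op == 7 then ccons x.-1 D else
  if op == 8 then ccons (chead x) D else ccons (ctail x) D.

(** [p] is the top of the control stack, [C] the rest, [D] the data stack.  A
loop whose test succeeds leaves itself on the control stack, below its body. *)
Definition control_step (p C D : nat) : nat :=
  if chead p == 0 then ccons (ccons (chead (ctail p)) (ccons (ctail (ctail p))
    C)) D else
  if chead p == 1 then
    if chead (chead D) == 0 then ccons C D else ccons (ccons (ctail p) (ccons
      p C)) D
  else ccons C (data_step (chead p) (chead D) (ctail D)).

(** A state is a coded pair of a control stack and a data stack.  The code 0
of the control stack means that the stack is empty and the machine has halted. *)
Definition step (s : nat) : nat :=
  if chead s == 0 then s else control_step (chead (chead s)) (ctail (chead s))
    (ctail s).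

Ltac computable_tac := repeat first
  [ apply: computable_const | assumption | apply: computable_chead | apply:
    computable_ctail
  | apply: computable_ccons | apply: computable_succ | apply: computable_pred
    | apply: computable_eq].

Lemma computable_step k F : computable k F ->
  computable k (fun v => step (F v)).
Proof. by move=> FP; rewrite /step /control_step /data_step;
  computable_tac. Qed.

Definition reaches (s t : nat) : Prop := exists n, iter n step s = t.

Lemma reaches_refl s : reaches s s. Proof. by exists 0. Qed.

Lemma reaches_trans t s u : reaches s t -> reaches t u -> reaches s u.
Proof. by move=> [m <-] [n <-]; exists (n + m); rewrite iterD. Qed.

Lemma reaches_step s t : step s = t -> reaches s t.
Proof. by exists 1. Qed.

Lemma step_control p C D : step (ccons (ccons p C) D) = control_step p C D.
Proof. by rewrite /step !(chead_ccons, ctail_ccons) eqn0Ngt ccons_gt0. Qed.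

(** Quantifying over both stacks makes the specification compositional. *)
Definition runs (p x y : nat) : Prop :=
  forall C D, reaches (ccons (ccons p C) (ccons x D)) (ccons C (ccons y D)).

Lemma reaches_seq p q C D :
  reaches (ccons (ccons (seq_op p q) C) D) (ccons (ccons p (ccons q C)) D).
Proof.
by apply: reaches_step; rewrite step_control /control_step !(chead_ccons,
  ctail_ccons).
Qed.

Lemma runs_seq p q x y z : runs p x y -> runs q y z -> runs (seq_op p q) x z.
Proof.
move=> pxy qyz C D; apply: reaches_trans (reaches_seq _ _ _ _) _.
exact: reaches_trans (pxy _ _) (qyz _ _).
Qed.

Lemma runs_while_stop b x : chead x = 0 -> runs (while_op b) x x.
Proof.
move=> x0 C D; apply: reaches_step.
by rewrite step_control /control_step !(chead_ccons, ctail_ccons) x0.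
Qed.

Lemma runs_while_loop b x y z : chead x <> 0 ->
  runs b x y -> runs (while_op b) y z -> runs (while_op b) x z.
Proof.
move=> /eqP /negbTE x0 bxy wyz C D.
apply: reaches_trans (reaches_trans (bxy (ccons (while_op b) C) D) (wyz _ _)).
by apply: reaches_step; rewrite step_control /control_step !(chead_ccons,
  ctail_ccons) x0.
Qed.

Lemma reaches_data op x C D : 1 < op ->
  reaches (ccons (ccons (ccons op 0) C) (ccons x D)) (ccons C (data_step op x
    D)).
Proof.
move=> op1; apply: reaches_step;
  rewrite step_control /control_step !(chead_ccons, ctail_ccons).
by case: op op1 => [|[]].
Qed.

(** The argument is duplicated, [p] is run on the copy, and [q] on the
original once it is back on top. *)
Definition fork_op (p q : nat) : nat :=
  seq_op dup_op (seq_op p (seq_op swap_op (seq_op q cons_op))).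

Lemma runs_fork p q x y z :
  runs p x y -> runs q x z -> runs (fork_op p q) x (ccons y z).
Proof.
move=> pxy qxz C D.
apply: reaches_trans (reaches_seq _ _ _ _) _.
apply: reaches_trans (reaches_data _ _ _ _) _ => //.
apply: reaches_trans (reaches_seq _ _ _ _) _.
apply: reaches_trans (pxy _ _) _.
apply: reaches_trans (reaches_seq _ _ _ _) _.
apply: reaches_trans (reaches_data _ _ _ _) _ => //.
rewrite /data_step /= !(chead_ccons, ctail_ccons).
apply: reaches_trans (reaches_seq _ _ _ _) _.
apply: reaches_trans (qxz _ _) _.
apply: reaches_trans (reaches_data _ _ _ _) _ => //.
by rewrite /data_step /= !(chead_ccons, ctail_ccons); apply: reaches_refl.
Qed.

Lemma runs_zero x : runs zero_op x 0.
Proof. by move=> C D; apply: reaches_data. Qed.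
Lemma runs_succ x : runs succ_op x x.+1.
Proof. by move=> C D; apply: reaches_data. Qed.
Lemma runs_pred x : runs pred_op x x.-1.
Proof. by move=> C D; apply: reaches_data. Qed.
Lemma runs_chead x : runs head_op x (chead x).
Proof. by move=> C D; apply: reaches_data. Qed.
Lemma runs_ctail x : runs tail_op x (ctail x).
Proof. by move=> C D; apply: reaches_data. Qed.

Lemma runs_chead_ccons a s : runs head_op (ccons a s) a.
Proof. by have := runs_chead (ccons a s); rewrite chead_ccons. Qed.
Lemma runs_ctail_ccons a s : runs tail_op (ccons a s) s.
Proof. by have := runs_ctail (ccons a s); rewrite ctail_ccons. Qed.

(** The tuple of arguments is passed as one coded sequence on the data stack.
Only the forward implication is needed: the machine is deterministic, so a
computed value is the only possible output. *)
Lemma compile k (f : recfun k) : exists p, forall (v : k.-tuple nat) y,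
  evalrec f v y -> runs p (CodeSeq.code v) y.
Proof.
elim: f => {k} [k||k i|k m f [p pP] g /choice [q qP]|k f [p pP] g [q qP]|k f
  [p pP]].
- by exists zero_op => v y ->; apply: runs_zero.
- exists (seq_op head_op succ_op) => v y /= ->; case/tupleP: v => x v.
  rewrite theadE code_cons.
  exact: runs_seq (runs_chead_ccons _ _) (runs_succ _).
- exists (iter i (seq_op tail_op) head_op) => v y /= ->.
  rewrite (tnth_nth 0); have : i < size (tval v) by rewrite size_tuple.
  elim: (val i) (tval v) => [|n IHn] [|x s] //= ns.
    exact: runs_chead_ccons.
  apply: runs_seq (runs_ctail_ccons _ _) _; exact: IHn.
- exists (seq_op (foldr (fun i r => fork_op (q i) r) zero_op (enum 'I_m)) p).
  move=> v y /= [w [gw fw]]; apply: runs_seq (pP _ _ fw).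
  have -> : tval w = [seq tnth w i | i <- enum 'I_m].
    by rewrite map_tnth_enum.
  elim: (enum _) => [|i s IHs]; first exact: runs_zero.
  exact: runs_fork (qP _ _ _ (gw i)) IHs.
(* The loop state is the sequence r, i, s i followed by the parameters, where
   r + i = n: the remaining number of rounds comes first because loops test
   the head. *)
- pose init := fork_op head_op (fork_op zero_op (fork_op (seq_op tail_op p)
  tail_op)).
  pose tl2 := seq_op tail_op tail_op.
  pose body := fork_op (seq_op head_op pred_op)
    (fork_op (seq_op tail_op (seq_op head_op succ_op))
             (fork_op (seq_op tail_op q) (seq_op tail_op tl2))).
  exists (seq_op init (seq_op (while_op body) (seq_op tl2 head_op))) => u y.
  case/tupleP: u => n v [s [s0 sS ->]]; rewrite theadE in sS *.
  rewrite [CodeSeq.code _](code_cons n v).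
  set c := CodeSeq.code v.
  have s0' := pP _ _ s0; rewrite /= -/c in s0'.
  apply: (@runs_seq _ _ _ (ccons n (ccons 0 (ccons (s 0) c)))).
    apply: runs_fork (runs_chead_ccons _ _) _.
    apply: runs_fork (runs_zero _) _.
    apply: runs_fork (runs_ctail_ccons _ _).
    exact: runs_seq (runs_ctail_ccons _ _) s0'.
  apply: (@runs_seq _ _ _ (ccons 0 (ccons n (ccons (s n) c)))); last first.
    apply: runs_seq (runs_chead_ccons _ _).
    exact: runs_seq (runs_ctail_ccons _ _) (runs_ctail_ccons _ _).
  have : forall r i, r + i = n ->
    runs (while_op body) (ccons r (ccons i (ccons (s i) c))) (ccons 0 (ccons n
      (ccons (s n) c))).
    elim=> [|r IHr] i rin.
      by rewrite -rin; apply: runs_while_stop; rewrite chead_ccons.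
    have iS : r + i.+1 = n by rewrite addnS.
    apply: runs_while_loop (IHr _ iS); first by rewrite chead_ccons.
    apply: runs_fork; first exact: runs_seq (runs_chead_ccons _ _) (runs_pred
      _).
    apply: runs_fork.
      apply: runs_seq (runs_ctail_ccons _ _) _.
      exact: runs_seq (runs_chead_ccons _ _) (runs_succ _).
    apply: runs_fork.
      apply: runs_seq (runs_ctail_ccons _ _) _.
      have /sS /qP : i < n by lia.
      by rewrite /= !code_cons.
    apply: runs_seq (runs_ctail_ccons _ _) _.
    exact: runs_seq (runs_ctail_ccons _ _) (runs_ctail_ccons _ _).
  by apply; rewrite addn0.
(* The loop state is f (i, v), i followed by v: the search stops when the
   head is 0.  The invariant r + i = y with r measuring the distance to the
   answer turns the two cases of the specification of Mu into one. *)
- pose id_op := seq_op succ_op pred_op.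
  have runs_id x : runs id_op x x by apply: runs_seq (runs_succ _) (runs_pred
    _).
  pose next := fork_op p id_op.
  pose incr := fork_op (seq_op head_op succ_op) tail_op.
  pose body := seq_op tail_op (seq_op incr next).
  exists (seq_op (fork_op zero_op id_op) (seq_op next
    (seq_op (while_op body) (seq_op tail_op head_op)))) => v y /= [y0 yS].
  set c := CodeSeq.code v.
  have next_runs i z : evalrec f [tuple of i :: v] z ->
      runs next (ccons i c) (ccons z (ccons i c)).
    by move=> /pP fz; apply: runs_fork.
  apply: (@runs_seq _ _ _ (ccons 0 c)); first exact: runs_fork (runs_zero _) _.
  have loop : forall r i z, r + i = y -> evalrec f [tuple of i :: v] z ->
      (r = 0 -> z = 0) -> (0 < r -> 0 < z) ->
      runs (while_op body) (ccons z (ccons i c)) (ccons 0 (ccons y c)).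
    elim=> [|r IHr] i z riy fz rz rz'.
      move: riy; rewrite add0n => <-.
      by rewrite rz; [apply: runs_while_stop; rewrite chead_ccons|].
    have iS : r + i.+1 = y by rewrite addnS.
    have [z' [fz' z'0 z'S]] : exists z', [/\ evalrec f [tuple of i.+1 :: v] z',
        r = 0 -> z' = 0 & 0 < r -> 0 < z'].
      case: (posnP r) iS => [r0|r0] iS.
        by move: iS; rewrite r0 add0n => ->; exists 0.
      have [|z' fz'] := yS i.+1; first by lia.
      by exists z'.+1; split=> // r1; rewrite r1 in r0.
    apply: runs_while_loop (IHr _ _ iS fz' z'0 z'S).
      by rewrite chead_ccons; have := rz' isT; case: (z).
    apply: runs_seq (runs_ctail_ccons _ _) _.
    apply: (@runs_seq _ _ _ (ccons i.+1 c)); last exact: next_runs.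
    apply: runs_fork (runs_ctail_ccons _ _).
    exact: runs_seq (runs_chead_ccons _ _) (runs_succ _).
  have [z [fz z0 zS]] : exists z, [/\ evalrec f [tuple of 0 :: v] z,
      y = 0 -> z = 0 & 0 < y -> 0 < z].
    case: (posnP y) => [y0'|y0']; first by exists 0; split=> //;
      rewrite -[in X in X :: _]y0'.
    by have [z fz] := yS 0 y0'; exists z.+1; split=> // y1; rewrite y1 in y0'.
  apply: runs_seq (next_runs _ _ fz) _.
  apply: runs_seq (loop _ _ _ (addn0 y) fz z0 zS) _.
  exact: runs_seq (runs_ctail_ccons _ _) (runs_chead_ccons _ _).
Qed.

(** * A computable function with undecidable range *)

(** The program [p] is alone on the control stack; its input is the coded
one-element sequence of [p] itself, as for a unary recursive function. *)
Definition initial (p : nat) : nat := ccons (ccons p 0) (ccons (ccons p 0) 0).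

Definition outputs (y s : nat) : Prop := chead s = 0 /\ chead (ctail s) = y.

Lemma outputs_unique s m n y z :
  outputs y (iter m step s) -> outputs z (iter n step s) -> y = z.
Proof.
have halt k t x : outputs x t -> iter k step t = t.
  by move=> [t0 _]; elim: k => //= k ->; rewrite /step t0.
wlog mn : m n y z / m <= n.
  by move=> W my nz; case/orP: (leq_total m n) => h; [|apply/esym];
    apply: W h _ _.
by move=> my; rewrite -(subnK mn) iterD (halt _ _ _ my) => -[_ <-]; case: my.
Qed.

Definition rejects_itself (p : nat) : Prop :=
  exists n, outputs 0 (iter n step (initial p)).

(** Diagonalization: compile a decision procedure [d] to [p] and ask whether
[p] outputs 0 on itself.  If it does, [d] answers 1 on [p], so [p] also outputs
1; if it does not, [d] answers 0, so [p] does output 0. *)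
Lemma rejects_itself_undecidable (d : recfun 1) :
  ~ forall p, (rejects_itself p -> evalrec d [tuple p] 1) /\
              (~ rejects_itself p -> evalrec d [tuple p] 0).
Proof.
move=> dP; have [p pP] := compile d.
have run y : evalrec d [tuple p] y ->
  exists n, outputs y (iter n step (initial p)).
  move=> /pP /(_ 0 0) [n nE]; exists n; rewrite /initial code_cons in nE *.
  by rewrite nE /outputs ctail_ccons chead_ccons chead_ccons.
have [pK|pK] := pselect (rejects_itself p); last exact/pK/run/(dP p).2.
have [n n0] := pK; have [m m1] := run 1 ((dP p).1 pK).
by have := outputs_unique n0 m1.
Qed.

(** The argument codes a pair of a running time and a program.  Programs are
shifted by one so that 0 can serve as the value of unsuccessful runs. *)
Definition enum_rejects (n : nat) : nat :=
  let s := iter (chead n) step (initial (ctail n)) in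
  if chead s == 0 then if chead (ctail s) == 0 then (ctail n).+1 else 0 else 0.

Lemma enum_rejectsP p : (exists n, enum_rejects n = p.+1) <-> rejects_itself p.
Proof.
split=> [[n]|[n [n0 n1]]]; last first.
  by exists (ccons n p); rewrite /enum_rejects !(chead_ccons,
    ctail_ccons) n0 n1.
rewrite /enum_rejects; case: eqP => // s0; case: eqP => // s1 [<-].
by exists (chead n).
Qed.

Lemma computable_enum_rejects k F : computable k F ->
  computable k (fun v => enum_rejects (F v)).
Proof.
move=> FP.
have SP : computable k (fun v => iter (chead (F v)) step (initial (ctail (F
  v)))).
  apply: (@computable_iter k _ _ (fun s _ => step s)).
  - exact: computable_chead.
  - by rewrite /initial; computable_tac.
  - exact/computable_step/computable_var.
by rewrite /enum_rejects; computable_tac.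
Qed.

(** * Congruences on words and actions by partial injections *)

Section Semigroups.
Import Algebra.
Local Open Scope group_scope.

Section InverseCongruences.
Variables (X : countType).
Implicit Types (u v w : word X) (R : set (word X * word X)).

(** The classical description of Vagner congruences by [w w^-1 w = w] and the
commutation of the idempotents [u u^-1] and [v v^-1]. *)
Lemma inverse_congruenceP (rho : congruence (word X)) :
    (forall w, rho (w * word_inv w * w) w) ->
    (forall u v, rho ((u * word_inv u) * (v * word_inv v))
                     ((v * word_inv v) * (u * word_inv u))) ->
  inverse_congruence rho.
Proof.
move=> regular commute.
have inv w : inverse_of (\pi_(Quot rho) w) (\pi_(Quot rho) (word_inv w)).
  have h u : \pi_(Quot rho) u * \pi_(Quot rho) (word_inv u) * \pi_(Quot rho) u =
             \pi_(Quot rho) u by rewrite -!QuotM; apply/Quot_eqP.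
  by split=> //; have := h (word_inv w); rewrite word_invK.
split=> [|x]; last first.
  have <- : word_inv (letter_word (inl x)) =
    letter_word (inr x) by exact: val_inj.
  exact: inv.
pose J (x y : Quot rho) := exists w,
  x = \pi_(Quot rho) w /\ y = \pi_(Quot rho) (word_inv w).
apply: (@inverse_semigroup_equational _ J).
- by move=> x; exists (\pi_(Quot rho) (word_inv (repr x))), (repr x);
  rewrite reprK.
- by move=> x y [w [-> ->]]; exists (word_inv w); rewrite word_invK.
- by move=> x y [w [-> ->]]; apply: inv.
move=> x x' y y' [u [-> ->]] [v [-> ->]].
by rewrite -!QuotM; apply/Quot_eqP.
Qed.

Definition cl R (w : word X) : InvSg R := \pi_(InvSg R) w.

Lemma clM R u v : cl R (u * v) = cl R u * cl R v.
Proof. exact: QuotM. Qed.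

Lemma cl_surj R (s : InvSg R) : exists w, s = cl R w.
Proof. by exists (repr s); rewrite /cl reprK. Qed.

Lemma cl_inv R w : inverse_of (cl R w) (cl R (word_inv w)).
Proof. exact: InvSg_word. Qed.

Lemma idem_comm R (e f : InvSg R) : e * e = e -> f * f = f -> e * f = f * e.
Proof. exact: inverse_idem_comm (@InvSg_inverse _ R) _ _. Qed.

Lemma cl_rel R u v : R (u, v) -> cl R u = cl R v.
Proof. by move=> Ruv; apply/Quot_eqP => rho; apply; left. Qed.

(** Elimination principle for inverse semigroup presentations: equality in
[InvSg R] implies any relation that respects [R] and has an inverse quotient. *)
Lemma cl_elim R (rho : congruence (word X)) : inverse_congruence rho ->
    (forall u v, R (u, v) -> rho u v) ->
  forall u v, cl R u = cl R v -> rho u v.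
Proof.
move=> invrho Rrho u v /Quot_eqP; apply => {}u {}v [/Rrho //|]; exact.
Qed.

Lemma word_invM u v : word_inv (u * v) = word_inv v * word_inv u.
Proof. by apply: val_inj; rewrite /= map_cat rev_cat. Qed.

End InverseCongruences.

(** Fixes the type of the underlying sequence, so that lemmas on sequences of
letters rewrite in it. *)
Definition letters (X : countType) (w : word X) : seq (letter X) := val w.

Lemma lettersM (X : countType) (u v : word X) :
  letters (u * v) = letters u ++ letters v.
Proof. by []. Qed.

Section Actions.
Variables (T : Type) (X : countType) (act1 : letter X -> T -> option T).

Definition act (w : seq (letter X)) (t : T) : option T :=
  foldl (fun s a => obind (act1 a) s) (Some t) w.

Lemma act_none w : foldl (fun s a => obind (act1 a) s) None w = None.
Proof. by elim: w. Qed.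

Lemma act_cat u v t : act (u ++ v) t = obind (act v) (act u t).
Proof. by rewrite /act foldl_cat; case: (foldl _ _ u) => //=;
  rewrite act_none. Qed.

Lemma act_cons a w t : act (a :: w) t = obind (act w) (act1 a t).
Proof. by rewrite -cat1s act_cat. Qed.

(** Each letter acts as a partial injection, and inverse letters as inverse
partial injections. *)
Hypothesis act1_inv : forall a s t,
  act1 a s = Some t <-> act1 (letter_inv a) t = Some s.

Lemma act_inv (w : seq (letter X)) s t :
  act w s = Some t -> act (rev (map (@letter_inv X) w)) t = Some s.
Proof.
elim: w s => [|a w IHw] s; first by case=> ->.
rewrite act_cons rev_cons -cats1 act_cat.
by case E: (act1 a s) => [u|] //= /IHw ->
  /=; rewrite act_cons; case: (act1_inv a s u) => /(_ E) ->.
Qed.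

Lemma act_mul_inv (w : word X) t :
  act (letters (w * word_inv w)) t = if act (letters w) t then Some t else None.
Proof. by rewrite lettersM act_cat; case E: (act (letters w) t) => //=;
  apply: act_inv. Qed.

(** If [w] is defined at [t] then [w w^-1] returns to [t], so a word that
starts with [w w^-1 p] and acts at [t] as [w] does forces [p] to be defined
there. *)
Lemma act_prefix (w : word X) p q t :
    act (letters (w * word_inv w) ++ p ++ q) t = act (letters w) t ->
  act (letters w) t -> act p t.
Proof.
rewrite act_cat act_mul_inv; case: (act (letters w) t) => //= s.
by rewrite act_cat; case: (act p t).
Qed.

Definition act_cong : congruence (word X).
Proof.
exists (fun u v => forall t, act (letters u) t = act (letters v) t).
- by [].
- by move=> u v uv t; rewrite uv.
- by move=> v u w uv vw t; rewrite uv vw.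
- move=> u v w z uv wz t; rewrite !lettersM !act_cat uv.
  by case: (act (letters v) t) => //= s; apply: wz.
Defined.

Lemma act_cong_inverse : inverse_congruence act_cong.
Proof.
apply: inverse_congruenceP => [w|u v] t.
  rewrite lettersM act_cat (act_mul_inv w).
  by case E: (act (letters w) t) => //=; rewrite E.
have mulE (x y : word X) : act (letters (x * word_inv x * (y * word_inv y))) t =
    if act (letters x) t then if act (letters y) t then Some t else None else
      None.
  rewrite lettersM act_cat (act_mul_inv x); case: (act (letters x) t) => //= _.
  exact: act_mul_inv.
by rewrite !mulE; case: (act (letters u) t); case: (act (letters v) t).
Qed.

End Actions.

(** * The chain of idempotents of a monogenic inverse semigroup *)

Section Spikes.
Variables (X : countType) (x : X).

(** Exponents are shifted by one because there is no empty word. *)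
Definition power (n : nat) : word X := Sub (nseq n.+1 (inl x : letter X)) isT.
Definition spike (n : nat) : word X := power n * word_inv (power n).

Lemma power_add m n : power (m + n).+1 = power m * power n.
Proof. by apply: val_inj; rewrite [RHS]/= -[RHS](nseqD m.+1 n.+1) addSn addnS.
  Qed.

Lemma letters_spike n : letters (spike n) =
  nseq n.+1 (inl x) ++ nseq n.+1 (inr x).
Proof.
rewrite -[LHS]/(nseq n.+1 (inl x) ++ rev (map (@letter_inv X) (nseq n.+1 (inl
  x)))).
by rewrite map_nseq rev_nseq.
Qed.

Lemma computable_spike k N : computable k N ->
  computable k (fun v => word_code (spike (N v))).
Proof.
move=> NP.
apply: computable_ext (_ : computable k (fun v => iter (N v).+1 (ccons
  (letter_code (inl x)))
  (iter (N v).+1 (ccons (letter_code (inr x))) 0))).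
  move=> v _; rewrite /word_code -/(letters _) letters_spike map_cat !map_nseq.
  have iterE m a s : iter m (ccons a) (CodeSeq.code s) =
    CodeSeq.code (nseq m a ++ s).
    by elim: m => //= m ->; rewrite code_cons.
  by rewrite -[0]/(CodeSeq.code [::]) !iterE cats0.
have stepP a : computable k.+2 (fun u => ccons a (nth 0 u 1)).
  by apply: computable_ccons; [apply: computable_const|apply: computable_var].
apply: (@computable_iter k _ _ (fun s _ => ccons _ s)) => //;
  first exact: computable_succ.
apply: (@computable_iter k _ _ (fun s _ => ccons _ s)) => //;
  first exact: computable_succ.
exact: computable_const.
Qed.

Variable R : set (word X * word X).

Lemma spike_idem n : cl R (spike n) * cl R (spike n) = cl R (spike n).
Proof. by rewrite /spike clM mulgA; case: (cl_inv R (power n)) => ->. Qed.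

(** If [m < n] then [a^(n+1)] begins with [a^(m+1)], on which
[a^(m+1) a^-(m+1)] is a left identity. *)
Lemma spike_mul m n : cl R (spike m) * cl R (spike n) = cl R (spike (maxn m n)).
Proof.
wlog mn : m n / m < n => [W|].
  case: (boolP (m < n)) => [/W //|];
    rewrite -leqNgt leq_eqVlt => /orP[/eqP ->|/W nm].
    by rewrite maxnn spike_idem.
  by rewrite (idem_comm (spike_idem m)) ?spike_idem // maxnC.
rewrite (maxn_idPr (ltnW mn)) -(subnKC mn) addSn /spike power_add.
rewrite !word_invM !clM !mulgA.
by case: (cl_inv R (power m)) => ->.
Qed.
End Spikes.

Lemma word_map_spike (X Y : countType) (f : X -> Y) x n :
  word_map f (spike x n) = spike (f x) n.
Proof.
apply: val_inj; rewrite -[LHS]/(map (letter_map f) (letters (spike x n)))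
  -[RHS]/(letters _).
by rewrite !letters_spike map_cat !map_nseq.
Qed.

End Semigroups.

(** * Finiteness of R-classes *)

Section FreeMonogenic.
Import Algebra.
Local Open Scope group_scope.

Section Factor.
Variables (X : countType) (R : set (word X * word X)).
Implicit Types (x y e f : InvSg R) (a l : letter X) (s : seq (letter X)).

(** A right action of possibly empty sequences, as the semigroup has no
identity. *)
Definition mul_letters x s : InvSg R :=
  foldl (fun y a => y * cl R (letter_word a)) x s.

Lemma mul_letters_rcons x s a :
  mul_letters x (rcons s a) = mul_letters x s * cl R (letter_word a).
Proof. by rewrite /mul_letters -cats1 foldl_cat. Qed.

Lemma mul_letters_nseqS x r a :
  mul_letters x (nseq r.+1 a) = mul_letters x (nseq r a) * cl R (letter_word a).
Proof. by rewrite -mul_letters_rcons -cats1 -[[:: a]]/(nseq 1%N a) -nseqD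
  addn1. Qed.

Lemma mul_mul_letters x y s : x * mul_letters y s = mul_letters (x * y) s.
Proof. by elim/last_ind: s => // s a IHs;
  rewrite !mul_letters_rcons mulgA IHs. Qed.

Lemma mul_letters_word x (w : word X) : x * cl R w = mul_letters x (letters w).
Proof.
elim/word_ind: w x => // a w IHw x.
by rewrite clM mulgA IHw.
Qed.

(** An idempotent [e] can be moved to the left through a letter: [p e] is
[(p e p^-1) p], and [p e p^-1] is again idempotent. *)
Lemma mul_letters_idem f e s : f * f = f -> e * e = e ->
  exists2 f', f' * f' = f' & mul_letters f s * e = mul_letters f' s.
Proof.
move=> ff; elim/last_ind: s e => [|s a IHs] e ee.
  exists (f * e) => //=.
  by rewrite !mulgA -(mulgA f e f) (idem_comm ee ff) !mulgA ff -!mulgA ee.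
have [h _] := cl_inv R (letter_word a).
set p := cl R (letter_word a) in h *; set q := cl R (word_inv _) in h *.
have qp : q * p * (q * p) = q * p by rewrite mulgA -(mulgA q) -(mulgA q) h.
have pe : p * e = p * e * q * p.
  by rewrite -[in LHS]h -!mulgA (mulgA q) (idem_comm qp ee) !mulgA.
have [|f' ff' f'P] := IHs (p * e * q).
  by rewrite !mulgA -pe -(mulgA p e e) ee.
exists f' => //; rewrite !mul_letters_rcons -f'P -!mulgA -/p; congr (_ * _).
by rewrite !mulgA -pe.
Qed.

(** Read a word from left to right.  The next letter either prolongs the
current power or cancels its last letter, and then the idempotent [l l^-1]
that appears is absorbed by [mul_letters_idem].  The hypothesis on [X] makes
any two letters equal or inverse to each other. *)
Lemma mul_letters_factor x : (forall a b : X, a = b) ->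
  exists f l r, f * f = f /\ x = mul_letters f (nseq r l).
Proof.
move=> X1; have [w ->] := cl_surj x; have [h _] := cl_inv R w.
rewrite -h mul_letters_word -clM.
have : cl R (w * word_inv w) * cl R (w * word_inv w) = cl R (w * word_inv w).
  by rewrite !clM mulgA h.
move: (cl R _) => f ff; have l0 : letter X by case: w {h ff} => -[].
elim/last_ind: (letters w) => [|s a [f1 [l [r [ff1 E]]]]].
  by exists f, l0, 0%N.
rewrite mul_letters_rcons E.
case: r {E} => [|r]; first by exists f1, a, 1%N.
case: (l =P a) => [->|la].
  by exists f1, a, r.+2; split=> //; rewrite [RHS]mul_letters_nseqS.
have -> : a = letter_inv l by case: l a la => [y|y] [z|z]; rewrite (X1 y z).
have [h1 _] := cl_inv R (letter_word l).
have [|f2 ff2 E2] := mul_letters_idem (nseq r l) ff1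
  (_ : cl R (letter_word l) * cl R (letter_word (letter_inv l)) *
     (cl R (letter_word l) * cl R (letter_word (letter_inv l))) = _).
  have <- : word_inv (letter_word l) =
    letter_word (letter_inv l) by exact: val_inj.
  by rewrite mulgA h1.
by exists f2, l, r; split=> //; rewrite -E2 mulgA mul_letters_nseqS.
Qed.

End Factor.

Section Shift.
Variable X : countType.

(** Every generator acts as the successor on the interval from 0 to [N]. *)
Definition shift (N : nat) (a : letter X) (i : nat) : option nat :=
  match a, i with
  | inl _, _ => if i < N then Some i.+1 else None
  | inr _, 0 => None
  | inr _, i'.+1 => if i' < N then Some i' else None
  end.

Lemma shift_inv N (a : letter X) i j :
  shift N a i = Some j <-> shift N (letter_inv a) j = Some i.
Proof.
by case: a i j => [x|x] [|i] [|j] /=; split; do 1?[case: ifP => // h [<-] //;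
  rewrite ?h //].
Qed.

Lemma act_shift_short N (s : seq (letter X)) i : size s <= i ->
  i + size s <= N -> act (shift N) s i.
Proof.
elim: s i => //= a s IHs i si iN; rewrite act_cons.
case: a i si iN => [x|x] [|i] //= si iN.
all: by case: ifP => [_|]; [apply: IHs; lia|lia].
Qed.

Lemma act_shift_power N n (l : letter X) i : i <= N ->
  act (shift N) (nseq n l) i -> n <= maxn i (N - i).
Proof.
move=> iN; case: l => x.
  move=> h; rewrite leq_max; apply/orP; right; move: h.
  elim: n i iN => //= n IHn i iN; rewrite act_cons /=.
  by case: ifP => // h /IHn; lia.
move=> h; rewrite leq_max; apply/orP; left; move: h.
elim: n i iN => //= n IHn [|i] iN; rewrite act_cons //=.
by case: ifP => // h /IHn; lia.
Qed.

End Shift.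

Lemma right_ideal_fix (S : semigroupType) (e x y : S) :
  e * x = x -> in_right_ideal y x -> e * y = y.
Proof. by move=> ex [->|[a ->]] //; rewrite mulgA ex. Qed.

(** Let [w] represent [x], and let [y] be in the [R]-class of [x], of the form
[f l^r] with [f] idempotent.  Then [E = w w^-1] fixes [y] and [f] fixes [x],
so [y = E l^r], and it only remains to bound [r].  As [x = y b] for some [b],
a word that starts with [w w^-1 l^r] represents [x].  In the shift action on
an interval of radius [|w|], [w] is defined at the centre, hence so is [l^r]:
this gives [r <= |w|]. *)
Lemma free_monogenic_finite_R_classes (X : countType) :
    (forall a b : X, a = b) ->
  finite_R_classes (InvSg (set0 : set (word X * word X))).
Proof.
move=> X1 x; set R := set0 in x *.
have [w xE] := cl_surj x.
pose E := cl R (w * word_inv w).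
have [h _] := cl_inv R w.
have Ex : E * x = x by rewrite /E xE clM h.
have a : X by case: (w) => -[|[a|a] s].
pose g (p : 'I_(size (letters w)).+1 * bool) :=
  mul_letters E (nseq p.1 (if p.2 then inl a else inr a : letter X)).
apply: (@sub_finite_set _ _ [set g p | p in [set: 'I_(size (letters w)).+1 *
  bool]]);
  last exact/finite_image/finite_finset.
move=> y /= [yx xy].
have Ey : E * y = y by exact: right_ideal_fix Ex yx.
have [f [l [r [ff yE]]]] := mul_letters_factor y X1.
have fy : f * y = y by rewrite yE mul_mul_letters ff.
have fx : f * x = x by exact: right_ideal_fix fy xy.
have xE' : in_right_ideal E x by right; exists (cl R (word_inv w));
  rewrite xE -clM.
have EE := right_ideal_fix Ex xE'.
have fE : E * f = E by rewrite (idem_comm EE ff) (right_ideal_fix fx xE').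
have {}yE : y = mul_letters E (nseq r l) by rewrite -Ey yE mul_mul_letters fE.
have rL : r < (size (letters w)).+1; last first.
  exists (Ordinal rL, if l is inl _ then true else false) => //.
  by rewrite {}yE /g /=; case: l => b; rewrite (X1 b a).
case: r yE => // n yE.
pose p : word X := Sub (nseq n.+1 l) isT.
have yw : y = cl R (w * word_inv w * p) by rewrite clM mul_letters_word.
have [v [vw [z vz]]] : exists v, cl R v = cl R w /\
    exists z, letters v = letters (w * word_inv w) ++ nseq n.+1 l ++ z.
  case: xy => [xy|[b]].
    exists (w * word_inv w * p); rewrite -xE -yw xy; split=> //.
    by exists [::]; rewrite cats0.
  have [u ->] := cl_surj b => xy.
  exists (w * word_inv w * p * u); rewrite clM -yw -xE -xy; split=> //.
  by exists (letters u); rewrite lettersM -catA.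
set L := size (letters w).
have wL : act (shift (L + L)) (letters w) L by apply: act_shift_short.
have : act (shift (L + L)) (letters v) L = act (shift (L + L)) (letters w) L.
  by apply: (cl_elim (act_cong_inverse (@shift_inv X (L + L))) _ vw).
rewrite vz => vE.
have qL : act (shift (L + L)) (nseq n.+1 l) L.
  exact: (act_prefix (@shift_inv X (L + L)) vE wL).
by have := act_shift_power (leq_addr _ _) qL; rewrite addKn maxnn.
Qed.

End FreeMonogenic.

(** * Separation of the two chains *)

Section Amalgam.
Import Algebra.
Local Open Scope group_scope.

Section Branching.
Variables (X : countType) (c : X -> bool) (k : nat).

(** The nodes of the tree are sequences of bits with the most recent step
first, so that [last] reads the first step from the root; [c x] is the child
taken by the generator [x].  A node of size at most [k] is always present, and
one of size [k + 1] only if its first step is [true]. *)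
Definition branch (a : letter X) (t : seq bool) : option (seq bool) :=
  match a with
  | inl x => if size t < k + last (c x) t then Some (c x :: t) else None
  | inr x => if t is b :: t' then
      if (b == c x) && (size t' < k + last b t') then Some t' else None
      else None
  end.

Lemma branch_inv a s t : branch a s = Some t <-> branch (letter_inv a) t =
  Some s.
Proof.
case: a => x /=; split.
- by case: ifP => // h [<-]; rewrite eqxx h.
- by case: t => // b t; case: eqP => //= ->; case: ifP => // h [<-]; rewrite h.
- by case: s => // b s; case: eqP => //= ->; case: ifP => // h [<-]; rewrite h.
- by case: ifP => // h [<-]; rewrite eqxx h.
Qed.

Lemma act_branch_power x n t :
  act branch (letters (power x n)) t =
    (size t + n.+1 <= k + last (c x) t) :> bool.
Proof.
rewrite -[letters _]/(nseq n.+1 (inl x)).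
elim: n t => [|n IHn] t.
  by rewrite /act /= addn1; case: ifP.
rewrite -[nseq _ _]/(inl x :: nseq n.+1 (inl x)) act_cons /=.
case: ifP => h; first by rewrite [obind _ _]/= IHn /= addSnnS.
by apply/esym/negbTE; rewrite /=; lia.
Qed.

Lemma act_branch_spike x n t : act branch (letters (spike x n)) t =
  if size t + n.+1 <= k + last (c x) t then Some t else None.
Proof. by rewrite (act_mul_inv branch_inv) -act_branch_power;
  case: (act _ _ _). Qed.

(** Away from the root the first step is already fixed, so the depth that is
available does not depend on the generator.  At the root it is [k] or [k + 1],
and only the spike of length [k + 1] distinguishes these. *)
Lemma act_branch_spike_eq x y n t : n <> k ->
  act branch (letters (spike x n)) t = act branch (letters (spike y n)) t.
Proof.
move=> nk; rewrite !act_branch_spike; case: t => //=.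
suff -> : (0 + n.+1 <= k + c x) = (0 + n.+1 <= k + c y) by [].
by case: (c x) (c y) => [] []; lia.
Qed.

End Branching.

Lemma act_branch_map (X Y : countType) (g : X -> Y) c k (w : word X) t :
  act (branch c k) (letters (word_map g w)) t =
    act (branch (c \o g) k) (letters w) t.
Proof.
rewrite -[letters _]/(map (letter_map g) (letters w)).
elim: (letters w) t => // a s IHs t; rewrite map_cons !act_cons.
have -> : branch c k (letter_map g a) t = branch (c \o g) k a t by case: a.
by case: (branch _ _ a t) => //= u.
Qed.

Lemma spike_inj (X : countType) (x : X) m n :
  cl set0 (spike x m) = cl set0 (spike x n) -> m = n.
Proof.
wlog mn : m n / m < n => [W E|].
  case: (ltngtP m n) => // h; first exact: W h E.
  exact/esym/(W _ _ h)/esym.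
move=> E; have : act (branch (fun=> false) m.+1) (letters (spike x m)) [::] =
  act (branch (fun=> false) m.+1) (letters (spike x n)) [::].
  exact: (cl_elim (act_cong_inverse (@branch_inv _ (fun=> false) m.+1)) _ E).
rewrite !act_branch_spike /= addn0 leqnn.
by rewrite ifF //; lia.
Qed.

Lemma word_mapM (X Y : countType) (g : X -> Y) (u v : word X) :
  word_map g (u * v) = word_map g u * word_map g v.
Proof. by apply: val_inj; rewrite /= map_cat. Qed.

Lemma word_map_inv (X Y : countType) (g : X -> Y) (w : word X) :
  word_map g (word_inv w) = word_inv (word_map g w).
Proof. by apply: val_inj; rewrite /= map_rev -!map_comp; congr rev;
  apply: eq_map; case. Qed.

Section Pullback.
Variables (X Y : countType) (g : X -> Y) (R : set (word Y * word Y)).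

Definition pullback_cong : congruence (word X).
Proof.
exists (fun u v => cl R (word_map g u) = cl R (word_map g v)) => //.
- by move=> y x z -> ->.
- by move=> x y z t xy zt; rewrite !word_mapM !clM xy zt.
Defined.

Lemma cl_map (u v : word X) :
  cl set0 u = cl set0 v -> cl R (word_map g u) = cl R (word_map g v).
Proof.
apply: (@cl_elim _ _ pullback_cong) => //.
apply: inverse_congruenceP => [w|{}u {}v];
  rewrite /= !word_mapM !word_map_inv !clM.
  by case: (cl_inv R (word_map g w)).
by apply: idem_comm; rewrite mulgA;
  [case: (cl_inv R (word_map g u)) => ->
    | case: (cl_inv R (word_map g v)) => ->].
Qed.

End Pullback.

(** * The amalgam of a function on natural numbers *)

Section Semilattice.
Variable f : nat -> nat.

(** The generator [y_n] and its inverse have codes [2n] and [2n+1], so halving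
the code recovers the index. *)
Definition weight (w : word nat) : nat :=
  \max_(a <- letters w) f (letter_code a)./2.

Lemma weightM u v : weight (u * v) = maxn (weight u) (weight v).
Proof. by rewrite /weight lettersM big_cat. Qed.

Lemma weight_letter a : weight (letter_word a) = f (letter_code a)./2.
Proof. by rewrite /weight big_seq1. Qed.

Lemma weight_generator n : weight (letter_word (inl n)) = f n.
Proof. by rewrite weight_letter /= doubleK. Qed.

Lemma weight_inv w : weight (word_inv w) = weight w.
Proof.
have invE a : weight (word_inv (letter_word a)) = weight (letter_word a).
  have -> : word_inv (letter_word a) = letter_word (letter_inv a).
    exact: val_inj.
  by rewrite !weight_letter; case: a => n /=; rewrite ?doubleK ?uphalf_double.
elim/word_ind: w => [a|a w IHw]; first exact: invE.
by rewrite word_invM !weightM IHw invE maxnC.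
Qed.

Lemma weight_range w : exists n, f n = weight w.
Proof.
elim/word_ind: w => [a|a w [n nE]]; first by rewrite weight_letter; eexists.
rewrite weightM; case: (leqP (weight (letter_word a)) (weight w)) => _;
  first by exists n.
by rewrite weight_letter; eexists.
Qed.

Definition weight_rel : set (word nat * word nat) :=
  [set p | weight p.1 = weight p.2].

Definition weight_cong : congruence (word nat).
Proof.
exists (fun u v => weight u = weight v) => //.
- by move=> y x z -> ->.
- by move=> x y z t xy zt; rewrite !weightM xy zt.
Defined.

Lemma cl_weight u v : cl weight_rel u = cl weight_rel v <-> weight u = weight v.
Proof.
split=> [|uv]; last exact: cl_rel.
apply: (@cl_elim _ _ weight_cong) => //.
apply: inverse_congruenceP => [w|{}u {}v] /=;
  rewrite !weightM !weight_inv ?maxnn //.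
exact: maxnC.
Qed.

Lemma weight_finite_R_classes : finite_R_classes (InvSg weight_rel).
Proof.
move=> x; apply: (@sub_finite_set _ _ [set x]) => // y /= [].
have [[u ->] [v ->]] := (cl_surj x, cl_surj y).
move=> [-> //|[a aE]] [-> //|[b bE]].
have [[w1 w1E] [w2 w2E]] := (cl_surj a, cl_surj b).
move: aE bE; rewrite w1E w2E -!clM => /cl_weight + /cl_weight.
by rewrite !weightM => h1 h2; apply/cl_weight; lia.
Qed.

Hypothesis computable_f : forall k F, computable k F ->
  computable k (fun v => f (F v)).

(** The state is the maximum found so far, followed by the codes of the letters
still to be read. *)
Definition weight_step (s : nat) : nat :=
  if ctail s == 0 then s
  else ccons (maxn (chead s) (f (chead (ctail s) %/ 2))) (ctail (ctail s)).

(** More steps than letters do no harm, so the code of the word itself can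
serve as the number of steps. *)
Lemma weight_stepP (l : seq nat) a n : size l <= n ->
  iter n weight_step (ccons a (CodeSeq.code l)) =
    ccons (maxn a (\max_(i <- l) f i./2)) 0.
Proof.
elim: l a n => [|b l IHl] a [|n] //.
- by rewrite big_nil maxn0.
- rewrite big_nil maxn0 => _; rewrite -[CodeSeq.code _]/0.
  by elim: n.+1 => //= m ->; rewrite /weight_step ctail_ccons.
- move=> /IHl E; rewrite iterSr {2}/weight_step code_cons !(chead_ccons,
  ctail_ccons) eqn0Ngt ccons_gt0 /=.
  by rewrite E big_cons divn2 maxnA.
Qed.

Lemma size_code (l : seq nat) : size l <= CodeSeq.code l.
Proof.
elim: l => //= a l IHl; rewrite code_cons.
apply: leq_trans (leq_pmull _ _); last by rewrite expn_gt0.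
by rewrite ltnS (leq_trans IHl) // -addnn leq_addr.
Qed.

Lemma weight_code (w : word nat) :
  chead (iter (word_code w) weight_step (ccons 0 (word_code w))) = weight w.
Proof.
rewrite weight_stepP ?size_code // chead_ccons max0n /weight big_map.
by [].
Qed.

Lemma computable_weight k F : computable k F ->
  computable k (fun v => chead (iter (F v) weight_step (ccons 0 (F v)))).
Proof.
move=> FP; apply: computable_chead.
apply: (@computable_iter k _ _ (fun s _ => weight_step s)) => //.
  by apply: computable_ccons => //; apply: computable_const.
have SP : computable k.+2 (fun u => nth 0 u 1) by exact: computable_var.
have fP : computable k.+2 (fun u => f (chead (ctail (nth 0 u 1)) %/ 2)).
  by apply: computable_f; apply: computable_div => //; computable_tac.
have mP := computable_max (computable_chead SP) fP.
by rewrite /weight_step; computable_tac.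
Qed.

Section Embedding.
Variables (X : countType) (x : X).

(** One definition serves both sides of the amalgam, which differ only in the
copy of the generator [x] once the generating sets are made disjoint. *)
Definition embed (q : InvSg weight_rel) : InvSg (set0 :
  set (word X * word X)) :=
  cl set0 (spike x (weight (repr q))).

Lemma embed_cl w : embed (cl weight_rel w) = cl set0 (spike x (weight w)).
Proof.
rewrite /embed; congr (cl _ (spike x _)).
by apply/cl_weight; rewrite {1}/cl reprK.
Qed.

Lemma embedM : {morph embed : p q / p * q}.
Proof.
move=> p q; have [[u ->] [v ->]] := (cl_surj p, cl_surj q).
by rewrite -clM !embed_cl weightM spike_mul.
Qed.

Lemma embed_inj : injective embed.
Proof.
move=> p q; have [[u ->] [v ->]] := (cl_surj p, cl_surj q).
by rewrite !embed_cl => /spike_inj uv; apply/cl_weight.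
Qed.

Lemma embed_computable : computable_map embed.
Proof.
have [g gP] : computable 1 (fun v => word_code (spike x
    (chead (iter (nth 0 v 0) weight_step (ccons 0 (nth 0 v 0)))))).
  by apply: computable_spike; apply: computable_weight; apply: computable_var.
exists g => w; exists (spike x (weight w)); split; last exact: embed_cl.
by have := gP [tuple word_code w]; rewrite /= weight_code.
Qed.

Definition embed_hom : Multiplicative.type (InvSg weight_rel) (InvSg set0) :=
  HB.pack embed (isMultiplicative.Build _ _ embed embedM).

Definition spike_amalgam :
    amalgam (InvSg (set0 : set (word X * word X)))
            (InvSg (set0 : set (word X * word X))) (InvSg weight_rel) :=
  @Amalgam _ _ _ (@InvSg_inverse _ _) (@InvSg_inverse _ _) (@InvSg_inverse _ _)
    embed_hom embed_hom embed_inj embed_inj.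

End Embedding.

End Semilattice.
End Amalgam.

(** If [k] is not a value of [f], the relations identify only [e_n] and [e'_n]
with [n <> k], whatever words [lambda1] and [lambda2] represent them by, and
[branch] respects these relations.  Yet [e_k] and [e'_k] act differently at the
root. *)
Lemma spike_amalgam_eq (f : nat -> nat) (X : countType) (x : X)
    (lambda1 lambda2 : InvSg (set0 : set (word X * word X)) -> word X) :
  (forall s, \pi_(InvSg set0) (lambda1 s) = s) ->
  (forall s, \pi_(InvSg set0) (lambda2 s) = s) ->
  let R := amalgam_rel (spike_amalgam f x) lambda1 lambda2 in
  forall k, cl R (spike (inl x) k) = cl R (spike (inr x) k) <-> exists n,
    f n = k.
Proof.
move=> l1 l2 R k.
have cl1 w : cl set0 (lambda1 (embed x (cl (weight_rel f) w))) =
    cl set0 (spike x (weight f w)) by rewrite -embed_cl; apply: l1.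
have cl2 w : cl set0 (lambda2 (embed x (cl (weight_rel f) w))) =
    cl set0 (spike x (weight f w)) by rewrite -embed_cl; apply: l2.
split=> [E|[n <-]]; last first.
  set w : word nat := letter_word (inl n).
  have wn : weight f w = f n by apply: weight_generator.
  rewrite -!word_map_spike -wn -(cl_map _ _ (cl1 w)) -(cl_map _ _ (cl2 w)).
  by apply: cl_rel; right; exists (cl (weight_rel f) w).
apply: contrapT => kf.
pose c (z : X + X) := if z is inr _ then true else false.
have act_eq g (u v : word X) t : cl set0 u = cl set0 v ->
    act (branch c k) (letters (word_map g u)) t =
    act (branch c k) (letters (word_map g v)) t.
  move=> uv; rewrite !act_branch_map.
  exact: (cl_elim (act_cong_inverse (@branch_inv _ (c \o g) k)) _ uv).
have := cl_elim (act_cong_inverse (@branch_inv _ c k)) _ E.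
move=> /(_ _ [::]) H; have {H} :
  act (branch c k) (letters (spike (inl x) k)) [::] =
    act (branch c k) (letters (spike (inr x) k)) [::].
  apply: H => u v [[[r []]|[r []]]|[q _ [<- <-]]] // t.
  have [w ->] := cl_surj q.
  rewrite /= (act_eq _ _ _ _ (cl1 w)) (act_eq _ _ _ _ (cl2 w)) !word_map_spike.
  apply: act_branch_spike_eq => wk; apply: kf.
  by rewrite -wk; apply: weight_range.
by rewrite !act_branch_spike /= addn0 addn1 leqnn ifF //; lia.
Qed.

(** * Undecidability *)

Theorem theorem1 :
  exists (X1 X2 : finType)
    (R1 : set (word X1 * word X1)) (R2 : set (word X2 * word X2))
    (P : set (word nat * word nat))
    (A : amalgam (InvSg R1) (InvSg R2) (InvSg P)),
    (finite_set R1 /\ finite_set R2) /\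
    (finite_R_classes (InvSg R1) /\ finite_R_classes (InvSg R2) /\
     finite_R_classes (InvSg P)) /\
    (computable_map (omega1 A) /\ computable_map (omega2 A)) /\
    (forall (lambda1 : InvSg R1 -> word X1) (lambda2 : InvSg R2 -> word X2),
      (forall s, \pi_(InvSg R1) (lambda1 s) = s) ->
      (forall s, \pi_(InvSg R2) (lambda2 s) = s) ->
      ~ decidable_word_problem (amalgam_rel A lambda1 lambda2)).
Proof.
pose X : finType := unit.
have finR : finite_R_classes (InvSg (set0 : set (word X * word X))).
  by apply: free_monogenic_finite_R_classes => -[] [].
exists X, X, set0, set0, (weight_rel enum_rejects),
  (spike_amalgam enum_rejects (tt : X)).
split; first by split; apply: finite_set0.
split; first by do !split=> //; apply: weight_finite_R_classes.
split; first by split; apply: embed_computable; apply: computable_enum_rejects.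
move=> l1 l2 l1P l2P [d dP].
have glueP k := spike_amalgam_eq enum_rejects (tt : X) l1P l2P k.
have spike_code (z : X + X) :
  computable 1 (fun v => word_code (spike z (nth 0 v 0).+1)).
  by apply: computable_spike; apply: computable_succ; apply: computable_var.
have [[g1 g1P] [g2 g2P]] := (spike_code (inl tt), spike_code (inr tt)).
pose e := Comp d (fun i : 'I_2 => if i == ord0 then g1 else g2).
apply: (@rejects_itself_undecidable e) => p.
have eE y : evalrec d [tuple word_code (spike (inl tt : X + X) p.+1);
    word_code (spike (inr tt : X + X) p.+1)] y -> evalrec e [tuple p] y.
  move=> dy; exists [tuple word_code (spike (inl tt : X + X) p.+1);
    word_code (spike (inr tt : X + X) p.+1)]; split=> // i.
  by case: i => [[|[|m]] mi].
split=> h; apply: eE; apply dP.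
  by apply/glueP/enum_rejectsP.
by move=> /glueP /enum_rejectsP.
Qed.
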